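(* Let $\sigma = \textrm{Prop} \cup \mathbb{A}$ be a modal signature with $\mathbb{A} = \{R_i \mid i \in I\}$, $I$ finite. If $M_a$ and $N_b$ are degree-finite $\sigma$-LTSs, then $M_a$ and $N_b$ satisfy the same formulas of $\textrm{ML}^{+,B,k}_\Diamond$ over $\sigma$ if and only if $\textrm{hom}_{\mathbb{B}}(\mathcal{A}^k_\sigma,M_a) = \textrm{hom}_{\mathbb{B}}(\mathcal{A}^k_\sigma,N_b)$.
   Context: A $\sigma$-LTS is a structure over a modal signature $\sigma$ (finitely many unary proposition letters and binary actions $R_i$, $i\in I$) with one distinguished element. It is degree-finite if every state has finitely many $\sigma$-successors and finitely many $\sigma$-predecessors. $\textrm{ML}^+_\Diamond$ (positive-existential modal logic) is built from proposition letters using $\land$, $\lor$ and the modalities $\Diamond_i$ (no negation, no box). A backward modality for action $R_i$, written here $\Diamond^{-,\geq k}_i$ (a ''black diamond'' in the paper), has semantics: $M,a \models \Diamond^{-,\geq k}_i \varphi$ iff there are at least $k$ elements $b$ with $R_i^M(b,a)$ and $M,b\models\varphi$. $\textrm{ML}^{+,B}_\Diamond$ is the extension of $\textrm{ML}^+_\Diamond$ with the backward modalities $\Diamond^{-,\geq 1}_i$, and $\textrm{ML}^{+,B,k}_\Diamond$ is its fragment of formulas of modal depth at most $k$. $\mathcal{A}^k_\sigma$ is the class of finite connected acyclic $\sigma$-LTSs of depth at most $k$ (connectedness and acyclicity via undirected paths of binary facts; depth of a state is the length of the shortest such path from the distinguished element). $\textrm{hom}_{\mathbb{B}}(\mathcal{C},M_a)$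 is the vector indexed by $\mathcal{C}$ whose entry at $T_c$ is $1$ if there is a homomorphism from $T_c$ to $M_a$ mapping $c$ to $a$ and $0$ otherwise (Boolean semiring counting).
   Formalization: The constant true (empty conjunction) is included among the formulas; without it the claim fails, e.g. for k ≥ 1 a state with a successor and an isolated state, no letters true, satisfy the same formulas but have different hom vectors. *)

(* Defs.v *)
From Stdlib Require List.
From mathcomp Require Import all_boot.
From mathcomp Require Import boolp classical_sets functions cardinality.
Set Implicit Arguments.
Unset Strict Implicit.
Unset Printing Implicit Defensive.

Local Open Scope classical_set_scope.

Record modal_signature := ModalSignature {
  props : finType;
  actions : finType
}.

Record LTS (sigma : modal_signature) := MkLTS {
  state :> Type;
  holds : props sigma -> state -> Prop;
  trans : actions sigma -> state -> state -> Prop;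
  point : state
}.

Section LTSNotions.
Variable sigma : modal_signature.
Implicit Types M N T : LTS sigma.

Definition successors M (x : M) : set M := [set y | exists i, trans i x y].
Definition predecessors M (x : M) : set M := [set y | exists i, trans i y x].

Definition degree_finite M : Prop :=
  forall x : M, finite_set (successors x) /\ finite_set (predecessors x).

(* The triple (i, x, y) stands for the binary fact R_i(x, y). *)
Definition fact M : Type := (actions sigma * M * M)%type.
Definition is_fact M (f : fact M) : Prop := trans f.1.1 f.1.2 f.2.

(* [traverses f x y]: f joins x to y, its direction being disregarded. *)
Definition traverses M (f : fact M) (x y : M) : Prop :=
  (f.1.2 = x /\ f.2 = y) \/ (f.1.2 = y /\ f.2 = x).

Fixpoint upath M (x : M) (s : seq (fact M)) (y : M) : Prop :=
  match s with
  | [::] => x = y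
  | f :: s' => exists z : M, [/\ is_fact f, traverses f x z & upath z s' y]
  end.

Definition connected M : Prop :=
  forall x y : M, exists s : seq (fact M), upath x s y.

(* A cycle is a nonempty closed undirected path in which no fact is repeated.
   Hence a loop R_i(x, x), a pair R_i(x, y), R_i(y, x), and two parallel facts
   R_i(x, y), R_j(x, y) with i <> j are all cycles. *)
Definition acyclic M : Prop :=
  forall (x : M) (s : seq (fact M)), upath x s x -> List.NoDup s -> s = [::].

Definition state_depth M (x : M) (d : nat) : Prop :=
  (exists2 s : seq (fact M), upath (point M) s x & size s = d) /\
  (forall s : seq (fact M), upath (point M) s x -> d <= size s).

Definition depth_at_most M (k : nat) : Prop :=
  forall (x : M) (d : nat), state_depth x d -> d <= k.

Definition acyclic_class (k : nat) : set (LTS sigma) :=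
  [set T : LTS sigma | [/\ finite_set [set: state T], connected T, acyclic T
             & depth_at_most T k]].

Definition is_hom T M (h : T -> M) : Prop :=
  [/\ forall p x, holds p x -> holds p (h x),
      forall i x y, trans i x y -> trans i (h x) (h y)
    & h (point T) = point M].

(* The Boolean semiring is bool, with 1 = true and 0 = false. *)
Definition homB (C : set (LTS sigma)) M : {T : LTS sigma | C T} -> bool :=
  fun t => `[< exists h : sval t -> M, is_hom h >].

(* The constant true is the empty conjunction. It is needed even when there are
   proposition letters: without it, every formula would fail at every state of
   an LTS in which no letter holds anywhere. *)
Inductive formula : Type :=
  | FTop
  | FProp of props sigma
  | FAnd of formula & formula
  | FOr of formula & formula
  | FDia of actions sigma & formula
  | FBack of actions sigma & formula.

Fixpoint modal_depth (phi : formula) : nat :=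
  match phi with
  | FTop | FProp _ => 0
  | FAnd phi1 phi2 | FOr phi1 phi2 =>
      maxn (modal_depth phi1) (modal_depth phi2)
  | FDia _ phi1 | FBack _ phi1 => (modal_depth phi1).+1
  end.

Definition at_least (n : nat) (X : Type) (A : set X) : Prop := (`I_n #<= A)%card.

Fixpoint sat M (x : M) (phi : formula) : Prop :=
  match phi with
  | FTop => True
  | FProp p => holds p x
  | FAnd phi1 phi2 => sat x phi1 /\ sat x phi2
  | FOr phi1 phi2 => sat x phi1 \/ sat x phi2
  | FDia i phi1 => exists y : M, trans i x y /\ sat y phi1
  | FBack i phi1 => at_least 1 [set y : M | trans i y x /\ sat y phi1]
  end.

Definition same_formulas_upto (k : nat) M N : Prop :=
  forall phi : formula, modal_depth phi <= k ->
    (sat (point M) phi <-> sat (point N) phi).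

End LTSNotions.

Arguments acyclic_class : clear implicits.
Arguments homB {sigma} C M _.

(* Main.v *)
From Stdlib Require List.
From mathcomp Require Import all_boot zify.
From mathcomp Require Import boolp classical_sets cardinality.
Require Import Defs.
Set Implicit Arguments.
Unset Strict Implicit.
Unset Printing Implicit Defensive.

(** A formula true at the point of [M] is already true in the unravelling of [M]
    by undirected walks of length at most [k], which belongs to the class of
    acyclic structures and maps homomorphically to [M]; positive formulas
    transfer along homomorphisms, so equal homomorphism vectors give equal
    theories.  Conversely, inclusion of depth-[k] theories yields, by
    degree-finiteness, a [k]-round directed simulation from [M] to [N].  An
    acyclic structure is ranked by the distance to its point: every fact joins
    two consecutive ranks and every state has at most one fact to a lower rank.
    Hence a homomorphism to [M] can be transported, one rank after the other,
    along the simulation to a homomorphism to [N]. *)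

Local Open Scope classical_set_scope.

(** * Finite sets, lists and counting up to one *)

Section SeqAndSetFacts.
Variable X : Type.

Lemma at_least1P (A : set X) : at_least 1 A <-> exists x, A x.
Proof.
split=> [A1|[x Ax]].
  apply: contrapT => A0; have AE : A = set0.
    by apply/seteqP; split=> // y Ay; apply: A0; exists y.
  move: A1; rewrite AE /at_least => /card_le0P I0.
  by have : (@set0 nat) 0 by rewrite -I0.
rewrite /at_least.
have inj : {in `I_1 &, injective (fun _ : nat => x)}.
  by move=> m n; rewrite !inE /=; lia.
rewrite -(card_le_eql (inj_card_eq inj)).
by apply: subset_card_le => _ [n _ <-].
Qed.

Lemma finite_set_list (A : set X) :
  finite_set A -> exists s : seq X, forall x, A x -> List.In x s.
Proof.
move=> /(@finite_seqP {classic X})[s AE]; exists s => x.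
rewrite AE /=; elim: s {AE} => //= y s IH.
by rewrite inE => /orP[/eqP->|/IH]; [left|right].
Qed.

Lemma List_In_last (x : X) s : List.In (last x s) (x :: s).
Proof.
elim: s x => [|y s IH] x /=; first by left.
by right; apply: IH.
Qed.

Lemma sval_inj (P : X -> Prop) : injective (@proj1_sig X P).
Proof.
move=> [x px] [y py] /= e; subst y; congr exist.
exact: Prop_irrelevance.
Qed.

End SeqAndSetFacts.

(** * Directed steps, undirected paths and preservation under homomorphisms *)

Section Steps.
Variable sigma : modal_signature.
Implicit Types M N T : LTS sigma.

(* The direction [b] tells whether R_i is followed forwards or backwards. *)
Definition step M (b : bool) (i : actions sigma) (x y : M) : Prop :=
  if b then trans i x y else trans i y x.

Definition mkfact M (b : bool) (i : actions sigma) (x y : M) : fact M :=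
  if b then (i, x, y) else (i, y, x).

Definition FStep (b : bool) (i : actions sigma) phi : formula sigma :=
  if b then FDia i phi else FBack i phi.

Lemma modal_depth_FStep b i phi :
  modal_depth (FStep b i phi) = (modal_depth phi).+1.
Proof. by case: b. Qed.

Lemma sat_FStep M b i (x : M) phi :
  sat x (FStep b i phi) <-> exists y : M, step b i x y /\ sat y phi.
Proof. by case: b => //; apply: at_least1P. Qed.

Lemma step_sym M b i (x y : M) : step b i x y -> step (~~ b) i y x.
Proof. by case: b. Qed.

Lemma mkfact_sym M b i (x y : M) : mkfact b i x y = mkfact (~~ b) i y x.
Proof. by case: b. Qed.

Lemma upath_cons M (x y : M) f s :
  upath x (f :: s) y <->
  exists b i z, [/\ step b i x z, f = mkfact b i x z & upath z s y].
Proof.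
split=> /= [[z [ff fxz zy]]|[b [i [z [xz -> zy]]]]].
  case: f ff fxz => [[i u] v] /= ff [[]|[]] /= eu ev; subst u v.
    by exists true, i, z.
  by exists false, i, z.
by exists z; split=> //; case: b xz => //= _; [left|right].
Qed.

Lemma upath1 M b i (x y : M) : step b i x y -> upath x [:: mkfact b i x y] y.
Proof. by move=> xy; apply/upath_cons; exists b, i, y. Qed.

Lemma upath_cat M (x y : M) s t :
  upath x (s ++ t) y <-> exists2 z, upath x s z & upath z t y.
Proof.
elim: s x => [|f s IH] x; first by split=> [xy|[z /= ->]//]; exists x.
rewrite cat_cons upath_cons; split.
  move=> [b [i [z [xz fE /IH[u zu uy]]]]]; exists u => //.
  by apply/upath_cons; exists b, i, z.
move=> [u /upath_cons[b [i [z [xz fE zu]]]] uy].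
by exists b, i, z; split=> //; apply/IH; exists u.
Qed.

Lemma upath_sym M (x y : M) s : upath x s y -> exists t, upath y t x.
Proof.
elim: s x => [|f s IH] x; first by move=> /= ->; exists [::].
move=> /upath_cons[b [i [z [xz _ /IH[t yz]]]]].
exists (t ++ [:: mkfact (~~ b) i z x]); apply/upath_cat; exists z => //.
exact/upath1/step_sym.
Qed.

Lemma is_hom_step T M (h : T -> M) b i x y :
  is_hom h -> step b i x y -> step b i (h x) (h y).
Proof. by case: b => -[_ ht _]; apply: ht. Qed.

(** No connective is negative and both modalities are existential, so every witness is carried along
    by [h]. *)
Lemma sat_hom T M (h : T -> M) x phi : is_hom h -> sat x phi -> sat (h x) phi.
Proof.
move=> hh; have [hp ht _] := hh.
elim: phi x => //=.
- by move=> f1 IH1 f2 IH2 x [/IH1 ? /IH2 ?].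
- by move=> f1 IH1 f2 IH2 x [/IH1 ?|/IH2 ?]; [left|right].
- by move=> i f IH x [y [xy /IH yf]]; exists (h y); split=> //; apply: ht.
- move=> i f IH x /at_least1P[y [xy /IH yf]].
  by apply/at_least1P; exists (h y); split=> //; apply: ht.
Qed.

End Steps.

(** * Rank functions as certificates of acyclicity *)

Section Ranked.
Variable sigma : modal_signature.
Implicit Types T : LTS sigma.

(** The second clause identifies the whole fact and not only the parent, so that parallel facts
    between a state and its parent are excluded. *)
Definition ranked T (d : T -> nat) : Prop :=
  (forall b i (x y : T), step b i x y -> d y = (d x).+1 \/ d x = (d y).+1) /\
  (forall b i b' i' (x x' y : T), step b i x y -> step b' i' x' y ->
     d y = (d x).+1 -> d y = (d x').+1 -> [/\ b = b', i = i' & x = x']).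

(* A path without repeated facts that goes up once cannot come down again,
   since the only way down is the fact just used. *)
Lemma ranked_path_up T (d : T -> nat) (x y z : T) b i s :
  ranked d -> step b i x z -> d z = (d x).+1 -> upath z s y ->
  List.NoDup (mkfact b i x z :: s) ->
  d x < d y /\ exists b' i' u,
    [/\ step b' i' u y, d y = (d u).+1 &
        last (mkfact b i x z) s = mkfact b' i' u y].
Proof.
move=> [d1 du]; elim: s x z b i => [|f s IH] x z b i xz dz.
  by move=> /= <- _; split; [lia|exists b, i, x].
move=> /upath_cons[b1 [i1 [w [zw fE wy]]]] nd.
have [dw|dw] := d1 _ _ _ _ zw.
  have [|lt [b' [i' [u [uy dy lE]]]]] := IH z w b1 i1 zw dw wy.
    by rewrite -fE; move/List.NoDup_cons_iff: nd => [].
  by split; [lia|exists b', i', u; split=> //=; rewrite fE].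
have [eb ei ew] := du _ _ _ _ _ _ _ xz (step_sym zw) dz dw.
move/List.NoDup_cons_iff: nd => [[]]; left.
by rewrite fE mkfact_sym eb ei ew.
Qed.

(** Once a path goes up it keeps going up. So it either descends throughout, losing one rank per
    fact, or ends with a fact that goes up. *)
Lemma ranked_path_last T (d : T -> nat) (x y : T) s :
  ranked d -> upath x s y -> List.NoDup s ->
  d y + size s = d x \/ exists b i u,
    [/\ step b i u y, d y = (d u).+1 & forall f, last f s = mkfact b i u y].
Proof.
move=> rd; elim: s x => [|f s IH] x.
  by move=> /= -> _; left; rewrite addn0.
move=> /upath_cons[b [i [z [xz fE zy]]]] nd.
have [dz|dz] := rd.1 _ _ _ _ xz.
  right; rewrite fE in nd.
  have [_ [b' [i' [u [uy dy lE]]]]] := ranked_path_up rd xz dz zy nd.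
  by exists b', i', u; split=> //= g; rewrite fE.
have [|zy'|[b' [i' [u [uy dy lE]]]]] := IH z zy.
- by move/List.NoDup_cons_iff: nd => [].
- by left => /=; lia.
- by right; exists b', i', u; split=> //= g; apply: lE.
Qed.

(** A cycle cannot descend throughout, so its last fact goes up to [x]. Its first fact cannot go up,
    as the rank would then increase strictly; so it goes down from [x], and by uniqueness it is the
    last fact again. *)
Lemma ranked_acyclic T (d : T -> nat) : ranked d -> acyclic T.
Proof.
move=> rd x [//|f s] xx nd; exfalso.
have [|[b' [i' [u [ux dx lE]]]]] := ranked_path_last rd xx nd.
  by move=> /=; lia.
move: xx => /upath_cons[b [i [z [xz fE zx]]]].
have [dz|dz] := rd.1 _ _ _ _ xz.
  rewrite fE in nd; have [lt _] := ranked_path_up rd xz dz zx nd.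
  by rewrite ltnn in lt.
have [eb ei ez] := rd.2 _ _ _ _ _ _ _ ux (step_sym xz) dx dz.
have {}lE : last f s = f by have /= -> := lE f; rewrite fE eb ei ez -mkfact_sym.
case: s lE zx nd => [|g s] /= lE zx nd; first by rewrite zx in dz; lia.
move/List.NoDup_cons_iff: nd => [[]]; rewrite -{1}lE.
exact: List_In_last.
Qed.

End Ranked.

(** * In acyclic structures the depth is a rank function *)

Section AcyclicRank.
Variables (sigma : modal_signature) (T : LTS sigma) (d : T -> nat).
Hypothesis state_depth_d : forall x, state_depth x (d x).

Lemma depth0 x : (d x = 0) <-> x = point T.
Proof.
have [[s sx ds] dmin] := state_depth_d x; split=> [d0|xp].
  by move: ds sx; rewrite d0 => /size0nil-> /=.
by have := dmin [::]; rewrite xp /= => /(_ erefl); lia.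
Qed.

Lemma depth_step b i x y : step b i x y -> d y <= (d x).+1.
Proof.
move=> xy; have [[s sx <-] _] := state_depth_d x.
have [_ dmin] := state_depth_d y.
rewrite -addn1 -(size_cat s [:: mkfact b i x y]); apply: dmin.
by apply/upath_cat; exists x => //; apply: upath1.
Qed.

(** The last fact of a shortest path from the point comes from depth exactly [n]. *)
Lemma depth_parent x n :
  d x = n.+1 -> exists b i y, step b i y x /\ d y = n.
Proof.
move=> dx; have [[s sx ds] dmin] := state_depth_d x.
case/lastP: s sx ds => [|s f] sx; first by rewrite dx.
rewrite size_rcons dx => -[ds].
move: sx; rewrite -cats1 => /upath_cat[y sy /upath_cons[b [i [z [yz _ /= zx]]]]].
rewrite zx in yz; exists b, i, y; split=> //.
have := depth_step yz; have [_ /(_ _ sy)] := state_depth_d y; lia.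
Qed.

(** A fact can be read in both directions; requiring the depth to increase selects one of them. *)
Lemma mkfact_depth_inj b i x y b' i' x' y' :
  mkfact b i x y = mkfact b' i' x' y' -> d x < d y -> d x' < d y' ->
  [/\ b = b', i = i', x = x' & y = y'].
Proof.
by case: b; case: b' => -[-> -> ->] // *; exfalso; lia.
Qed.

Lemma mkfact_depth_add b i x y :
  d (mkfact b i x y).1.2 + d (mkfact b i x y).2 = d x + d y.
Proof. by case: b => //=; rewrite addnC. Qed.

(* The bound on depths makes the path avoid every fact between two states of
   depth [n] and every fact that reaches depth [n.+1]. *)
Lemma low_path n x y : d x = n -> d y = n ->
  exists s, [/\ upath x s y, List.NoDup s &
    forall f, List.In f s -> d f.1.2 + d f.2 < n.*2].
Proof.
elim: n x y => [|n IH] x y dx dy.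
  exists [::]; split=> //; last exact: List.NoDup_nil.
  by rewrite (depth0 x).1 // (depth0 y).1.
(* For [x = y] the facts to the two parents could coincide, so this case is settled first. Otherwise
   the parents are joined by induction; the two new facts have depth sum [n + n.+1], too large to
   occur on that path. *)
have [->|xy] := pselect (x = y).
  by exists [::]; split=> //; exact: List.NoDup_nil.
have [b [i [u [ux du]]]] := depth_parent dx.
have [b' [i' [v [vy dv]]]] := depth_parent dy.
have [s [uv nd low]] := IH u v du dv.
have sumf := mkfact_depth_add b i u x.
have sumg := mkfact_depth_add b' i' v y.
exists (mkfact b i u x :: (s ++ [:: mkfact b' i' v y])); split.
- apply/upath_cons; exists (~~ b), i, u; split; first exact: step_sym.
    exact: mkfact_sym.
  by apply/upath_cat; exists v => //; apply: upath1.
- apply/List.NoDup_cons; last first.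
    apply: List.NoDup_app => //.
      by apply: List.NoDup_cons => //; exact: List.NoDup_nil.
    by move=> f /low fs [fE|//]; rewrite -fE in fs; lia.
  move=> /List.in_app_iff[/low|[fE|//]]; first lia.
  by have [] := mkfact_depth_inj fE; (lia || move=> *; exact: xy).
- move=> f [<-|/List.in_app_iff[/low|[<-|//]]]; lia.
Qed.

(** A fact between states of equal depth, or two distinct facts reaching [y] from the depth below,
    would be closed to a cycle by a low path, which avoids these facts because of their depth
    sums. *)
Lemma acyclic_ranked : acyclic T -> ranked d.
Proof.
move=> acT; split=> [b i x y xy|b i b' i' x x' y xy x'y dy dy'].
  have := depth_step xy; have := depth_step (step_sym xy) => dyx dxy.
  have [dE|] : d x = d y \/ d x <> d y by lia.
    have [s [yx nd low]] := low_path (esym dE) erefl.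
    have sumf := mkfact_depth_add b i x y.
    suff : mkfact b i x y :: s = [::] by [].
    apply: (acT x); first by apply/upath_cons; exists b, i, y.
    by apply: List.NoDup_cons => // /low; lia.
  by lia.
have [fE|fNE] := pselect (mkfact b i x y = mkfact b' i' x' y).
  by have [] := mkfact_depth_inj fE; (lia || split).
have [s [xx' nd low]] : exists s, [/\ upath x s x', List.NoDup s &
    forall f, List.In f s -> d f.1.2 + d f.2 < (d x).*2].
  by apply: low_path => //; lia.
have sumf := mkfact_depth_add b i x y.
have sumg := mkfact_depth_add b' i' x' y.
suff : mkfact b i x y :: (s ++ [:: mkfact b' i' x' y]) = [::] by [].
apply: (acT y).
  apply/upath_cons; exists (~~ b), i, x; split; first exact: step_sym.
    exact: mkfact_sym.
  by apply/upath_cat; exists x' => //; apply: upath1.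
apply/List.NoDup_cons.
  by move=> /List.in_app_iff[/low|[fE|//]]; [lia|exact: fNE].
apply: List.NoDup_app => //.
  by apply: List.NoDup_cons => //; exact: List.NoDup_nil.
by move=> f /low fs [fE|//]; rewrite -fE in fs; lia.
Qed.

End AcyclicRank.

Lemma connected_state_depth (sigma : modal_signature) (T : LTS sigma) :
  connected T -> forall x : T, exists n, state_depth x n.
Proof.
move=> cT x; have [s sx] := cT (point T) x.
pose P n := `[< exists2 t, upath (point T) t x & size t = n >].
have exP : exists n, P n by exists (size s); apply/asboolP; exists s.
have [n /asboolP Pn nmin] := ex_minnP exP.
by exists n; split=> // t tx; apply: nmin; apply/asboolP; exists t.
Qed.

(** * Inclusion of theories as a simulation, and transport of homomorphisms *)

Section Simulation.
Variable sigma : modal_signature.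
Implicit Types M N T : LTS sigma.

Definition theory_le M N (n : nat) (x : M) (y : N) : Prop :=
  forall phi, modal_depth phi <= n -> sat x phi -> sat y phi.

(** Otherwise each of the finitely many candidates for [y'] refutes a formula of depth at most [n]
    true at [x']; the conjunction of these formulas under the modality holds at [x] and fails at
    [y]. *)
Lemma theory_le_step M N n (x x' : M) (y : N) b i :
  degree_finite N -> theory_le n.+1 x y -> step b i x x' ->
  exists2 y', step b i y y' & theory_le n x' y'.
Proof.
move=> fN le xx'; apply: contrapT => Nex.
have [s yP] : exists s : seq N, forall z, step b i y z -> List.In z s.
  have [fs fp] := fN y; have [ss ssP] := finite_set_list fs.
  have [sp spP] := finite_set_list fp.
  case: b {xx' Nex}.
    by exists ss => z yz; apply: ssP; exists i.
  by exists sp => z yz; apply: spP; exists i.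
have [phi [dphi xphi sphi]] : exists phi, [/\ modal_depth phi <= n, sat x' phi &
    forall z, List.In z s -> step b i y z -> ~ sat z phi].
  (* The list may contain states that are not reached from [y] by [b] and [i]; these add no
     conjunct. *)
  elim: s {yP} => [|z s [phi [dphi xphi sphi]]]; first by exists (FTop sigma).
  have [yz|yz] := pselect (step b i y z); last first.
    by exists phi; split=> // w [<-//|]; apply: sphi.
  have /existsNP[psi /not_implyP[dpsi /not_implyP[xpsi zpsi]]] :
    ~ theory_le n x' z by move=> zle; apply: Nex; exists z.
  exists (FAnd phi psi); split=> //=; first by rewrite geq_max dphi dpsi.
  by move=> w [<- _ []//|/sphi ws /ws ? []].
have /sat_FStep[z [yz zphi]] : sat y (FStep b i phi).
  apply: le; first by rewrite modal_depth_FStep.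
  by apply/sat_FStep; exists x'.
exact: (sphi z (yP z yz) yz zphi).
Qed.

Lemma hom_transfer k T M N (h : T -> M) :
  degree_finite N -> acyclic_class sigma k T -> is_hom h ->
  theory_le k (point M) (point N) -> exists g : T -> N, is_hom g.
Proof.
move=> fN [_ cT aT dT] hh MN.
have [d sd] := choice (connected_state_depth cT).
have [d1 du] := acyclic_ranked sd aT.
have dk x : d x <= k by apply: dT (sd x).
(* The map is total at every stage, but only its values up to depth [n] are constrained. Each step
   away from the point costs one unit of modal depth, which leaves [k - d t] at [t]. *)
have ext n : exists g : T -> N, [/\ g (point T) = point N,
    forall t, d t <= n -> theory_le (k - d t) (h t) (g t) &
    forall b i x t, d t <= n -> d t = (d x).+1 -> step b i x t ->
      step b i (g x) (g t)].
  elim: n => [|n [g [gp gle gstep]]].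
    exists (fun=> point N); split=> // [t dt|b i x t]; last by lia.
    have d0 : d t = 0 by lia.
    by rewrite d0 subn0 ((depth0 sd t).1 d0) (let: And3 _ _ e := hh in e).
  have [t|g' g'P] := @choice _ _ (fun t z => (d t <= n -> z = g t) /\
      (d t = n.+1 -> theory_le (k - d t) (h t) z /\
        forall b i x, d t = (d x).+1 -> step b i x t -> step b i (g x) z)) _.
    have [dt|dt] : d t = n.+1 \/ d t <> n.+1 by lia.
      have [b [i [x [xt dx]]]] := depth_parent sd dt.
      have le : theory_le (k - d t).+1 (h x) (g x).
        (* The bound [d t <= k] keeps the subtraction from being truncated. *)
        have -> : (k - d t).+1 = k - d x by have := dk t; lia.
        by apply: gle; lia.
      have [z xz zle] := theory_le_step fN le (is_hom_step hh xt).
      exists z; split; first by lia.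
      (* The image [z] was chosen for one fact below [t]; by uniqueness it is the only one. *)
      move=> _; split=> // b' i' x' dx' x't.
      by have [|<- <- <-] := du _ _ _ _ _ _ _ xt x't _ dx'; first lia.
    by exists (g t); split.
  have old t : d t <= n -> g' t = g t by move=> dt; apply: (g'P t).1.
  exists g'; split.
  - by rewrite old // (depth0 sd _).2.
  - move=> t dt; have [dt'|dt'] : d t <= n \/ d t = n.+1 by lia.
      by rewrite old //; apply: gle.
    by have [] := (g'P t).2 dt'.
  - move=> b i x t dt dx xt; rewrite (old x); last by lia.
    have [dt'|dt'] : d t <= n \/ d t = n.+1 by lia.
      by rewrite old //; apply: gstep.
    by have [_] := (g'P t).2 dt'; apply.
have [g [gp gle gstep]] := ext k.
exists g; split=> //.
  move=> p x px; apply: (gle x (dk x) (FProp p)) => //=.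
  by have [hp _ _] := hh; apply: hp.
move=> i x y xy.
(* Every fact is read in the direction in which the depth increases. *)
have [dy|dx] := d1 true i x y xy; first exact: (gstep true i x y).
exact: (gstep false i y x).
Qed.

End Simulation.

(** * The unravelling by undirected walks of bounded length *)

Section Unravelling.
Variables (sigma : modal_signature) (M : LTS sigma).

(* A walk is listed with its last step first, so that the parent of a walk in
   the unravelling is its tail.  Actions are recorded by their codes because the
   universe of [actions sigma] is above that of the states of an LTS. *)
Definition walk := seq (bool * nat * M).

Definition walk_end (w : walk) : M := if w is e :: _ then e.2 else point M.

Fixpoint is_walk (w : walk) : Prop :=
  if w is e :: w' then
    (exists2 i, e.1.2 = pickle i & step e.1.1 i (walk_end w') e.2) /\ is_walk w'
  else True.

Definition walks_upto (k : nat) : set walk :=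
  [set w | is_walk w /\ size w <= k].

Lemma finite_walks_upto k : degree_finite M -> finite_set (walks_upto k).
Proof.
move=> fM; elim: k => [|k IH].
  apply: (@sub_finite_set _ _ [set [::]]); last exact: finite_set1.
  by move=> [|e w] [_].
(* An overestimate of the extensions of [w]: the new end is any neighbour, whatever the label. *)
pose next (w : walk) (bi : bool * actions sigma) : set walk :=
  [set (bi.1, pickle bi.2, y) :: w | y in
      successors (walk_end w) `|` predecessors (walk_end w)].
apply: (@sub_finite_set _ _ ([set [::]] `|`
    \bigcup_(w in walks_upto k)
      \bigcup_(bi in [set: bool * actions sigma]) next w bi)).
  move=> [|[[b c] y] w] [/= ww sw]; first by left.
  case: ww => -[i -> wy] ww; right; exists w; first by [].
  exists (b, i) => //; exists y => //.
  by case: b wy => wy; [left|right]; exists i.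
rewrite finite_setU; split; first exact: finite_set1.
apply: bigcup_finite => // w _; apply: bigcup_finite => // bi _.
by apply: finite_image; rewrite finite_setU; apply: fM.
Qed.

(** Facts join a walk to its one-step extensions only; the recorded direction decides which of the
    two is the source. *)
Definition unravelling (k : nat) : LTS sigma :=
  @MkLTS sigma {w : walk | walks_upto k w}
    (fun p u => holds p (walk_end (sval u)))
    (fun i u v => (exists y, sval v = (true, pickle i, y) :: sval u) \/
                  (exists y, sval u = (false, pickle i, y) :: sval v))
    (exist _ [::] (conj I (leq0n k))).

Lemma unravelling_stepP k b i (u v : unravelling k) :
  step b i u v <-> (exists y, sval v = (b, pickle i, y) :: sval u) \/
                   (exists y, sval u = (~~ b, pickle i, y) :: sval v).
Proof. by case: b => //=; rewrite /step /=; tauto. Qed.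

Lemma walk_end_hom k :
  @is_hom sigma (unravelling k) M (fun u => walk_end (sval u)).
Proof.
split=> // i u v [[y vE]|[y uE]].
  by have [+ _] := svalP v; rewrite vE /= => -[[j /(pcan_inj pickleK) <-]].
by have [+ _] := svalP u; rewrite uE /= => -[[j /(pcan_inj pickleK) <-]].
Qed.

(** The head of the longer walk records direction and action, and its tail is the parent, so the
    fact below a walk is unique. *)
Lemma unravelling_ranked k :
  @ranked sigma (unravelling k) (fun u => size (sval u)).
Proof.
split=> [b i u v /unravelling_stepP[[y ->]|[y ->]]|]; [by left|by right|].
move=> b i b' i' u u' v /unravelling_stepP uv /unravelling_stepP uv' du du'.
case: uv => -[y uE]; last by move: du; rewrite uE /=; lia.
case: uv' => -[y' uE']; last by move: du'; rewrite uE' /=; lia.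
by move: uE'; rewrite uE => -[-> /(pcan_inj pickleK)-> _ /sval_inj->].
Qed.

(** Following the prefixes of a walk gives both connectedness and the bound on depths. *)
Lemma unravelling_root_path k (u : unravelling k) :
  exists2 s, upath (point (unravelling k)) s u & size s = size (sval u).
Proof.
case: u => w wk; elim: w wk => [|[[b c] y] w IH] wk.
  by exists [::] => //=; apply: sval_inj.
have wk' : walks_upto k w by case: wk => -[_ ww] /= sw; split=> //; apply: ltnW.
have [i /= cE _] := wk.1.1.
have [s sw ss] := IH wk'.
pose u : unravelling k := exist _ w wk'.
pose v : unravelling k := exist _ _ wk.
exists (s ++ [:: mkfact b i u v]); last by rewrite size_cat ss addn1.
apply/upath_cat; exists u => //; apply: upath1.
by apply/unravelling_stepP; left; exists y; rewrite -cE.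
Qed.

Lemma unravelling_acyclic_class k :
  degree_finite M -> acyclic_class sigma k (unravelling k).
Proof.
move=> fM; split.
- have -> : [set: unravelling k] =
      (fun u : unravelling k => sval u) @^-1` (walks_upto k).
    by apply/seteqP; split=> // u _; apply: svalP.
  apply: finite_preimage; last exact: finite_walks_upto.
  by move=> u v _ _; apply: sval_inj.
- move=> u v; have [s su _] := unravelling_root_path u.
  have [t tv _] := unravelling_root_path v.
  have [s' us] := upath_sym su.
  by exists (s' ++ t); apply/upath_cat; exists (point (unravelling k)).
- exact: ranked_acyclic (@unravelling_ranked k).
- move=> u n [_ dmin]; have [s su ss] := unravelling_root_path u.
  have [_ uk] := svalP u.
  by apply: leq_trans (dmin s su) _; rewrite ss.
Qed.

Lemma unravelling_step k b i (u : unravelling k) y :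
  size (sval u) < k -> step b i (walk_end (sval u)) y ->
  exists v : unravelling k, [/\ step b i u v, walk_end (sval v) = y &
    size (sval v) = (size (sval u)).+1].
Proof.
move=> uk uy; have vk : walks_upto k ((b, pickle i, y) :: sval u).
  by split=> //; split; [exists i|exact: (svalP u).1].
exists (exist _ _ vk); split=> //.
by apply/unravelling_stepP; left; exists y.
Qed.

(** The size condition ensures that evaluating [phi] never requires a walk longer than [k], so each
    witness in [M] lifts to an extended walk. *)
Lemma sat_unravelling k phi (u : unravelling k) :
  size (sval u) + modal_depth phi <= k ->
  sat (walk_end (sval u)) phi -> sat u phi.
Proof.
elim: phi u => //=.
- move=> f1 IH1 f2 IH2 u uk [u1 u2].
  by split; [apply: IH1|apply: IH2] => //; lia.
- move=> f1 IH1 f2 IH2 u uk [u1|u2].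
    by left; apply: IH1 => //; lia.
  by right; apply: IH2 => //; lia.
- move=> i f IH u uk [y [uy yf]].
  have [|v [uv vE sv]] := unravelling_step _ (uy : step true i _ y); first lia.
  by exists v; split=> //; apply: IH; rewrite ?vE ?sv //; lia.
- move=> i f IH u uk /at_least1P[y [uy yf]]; apply/at_least1P.
  have [|v [uv vE sv]] := unravelling_step _ (uy : step false i _ y); first lia.
  by exists v; split=> //; apply: IH; rewrite ?vE ?sv //; lia.
Qed.

End Unravelling.

(** * From homomorphism vectors to theories, and the equivalence *)

Lemma homB_theory_le (sigma : modal_signature) (k : nat) (M N : LTS sigma) :
  degree_finite M ->
  homB (acyclic_class sigma k) M = homB (acyclic_class sigma k) N ->
  theory_le k (point M) (point N).
Proof.
move=> fM MN phi phik Mphi.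
pose t : {T | acyclic_class sigma k T} :=
  exist _ (unravelling M k) (unravelling_acyclic_class k fM).
have : homB (acyclic_class sigma k) M t.
  (* The entry of [M] at its own unravelling is 1, so the unravelling also maps to [N]. *)
  by apply/asboolP; eexists; apply: walk_end_hom.
rewrite MN => /asboolP[g hg]; have [_ _ <-] := hg.
by apply: (sat_hom hg); apply: sat_unravelling.
Qed.

Theorem theorem3p5 (sigma : modal_signature) (k : nat) (M N : LTS sigma)
  (hM : degree_finite M) (hN : degree_finite N) :
  same_formulas_upto k M N <->
  homB (acyclic_class sigma k) M = homB (acyclic_class sigma k) N.
Proof.
split=> [MN|MN phi phik].
  apply/funext => -[T Tk]; apply: asbool_equiv_eq.
  split=> -[h hh]; apply: (hom_transfer _ Tk hh) => // phi /MN MNphi;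
    by apply MNphi.
split; apply: homB_theory_le phik => //; exact: esym.
Qed.
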